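(* Let $k\ge 1$ and let $\pi=011\cdots 1$ be the pattern consisting of a zero followed by $k$ ones. Then for all $n\ge 1$, \[ |\mathbf{I}_n(\pi)| = |L'_{n+1,k-1}|. \]
   Context: An inversion sequence of length $n$ is a sequence of integers $e=e_1\cdots e_n$ with $0\le e_i<i$ for all $1\le i\le n$; the set of these is $\mathbf{I}_n$. A sequence $e$ contains a pattern (finite integer sequence) $\pi$ of length $m$ if there are indices $i_1<\cdots<i_m$ such that $e_{i_1}\cdots e_{i_m}$ is order isomorphic to $\pi$ (i.e. its entries compare pairwise, with respect to $<,=,>$, exactly as the corresponding entries of $\pi$); otherwise it avoids $\pi$. $\mathbf{I}_n(\pi)$ is the set of $e\in\mathbf{I}_n$ avoiding $\pi$. A label-increasing tree on $n$ vertices is a rooted unordered tree in which the $n$ vertices are labeled with distinct labels from $\{0,\dots,n-1\}$ and labels increase along any path from the root to a leaf. $L'_{n,k}$ denotes the set of $n$-vertex label-increasing trees in which every vertex other than the root has at most $k$ children (the number of children of the root is unrestricted). *)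

(* Defs.v *)
From mathcomp Require Import all_boot.
From mathcomp Require Import boolp.

Set Implicit Arguments.
Unset Strict Implicit.
Unset Printing Implicit Defensive.

Definition order_isomorphic (s t : seq nat) : Prop :=
  size s = size t /\
  forall i j, i < size s -> j < size s ->
    (nth 0 s i < nth 0 s j) = (nth 0 t i < nth 0 t j) /\
    (nth 0 s i == nth 0 s j) = (nth 0 t i == nth 0 t j).

Definition contains_pattern (e p : seq nat) : Prop :=
  exists2 s, subseq s e & order_isomorphic s p.

(* Positions are numbered from 0, so the bound [0 <= e_i < i] for 1-based [i]
   becomes [e_i < i.+1]. It forces every entry below [n], which is why entries
   can be taken in ['I_n] (a finite type) without loss. *)
Definition inversion_sequences n : {set n.-tuple 'I_n} :=
  [set e : n.-tuple 'I_n | [forall i : 'I_n, tnth e i < i.+1]].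

Definition inversion_sequences_avoiding n (p : seq nat) : {set n.-tuple 'I_n} :=
  [set e in inversion_sequences n |
    ~~ `[< contains_pattern [seq val x | x <- e] p >]].

(* A graph on ['I_n] is given by its set of edges, each a two-element set. *)
Section Graphs.
Variables (n : nat) (E : {set {set 'I_n}}).

Definition simple_graph : Prop := forall e, e \in E -> #|e| = 2.

Definition adjacent : rel 'I_n := fun x y => [set x; y] \in E.

Definition connected_graph : Prop := forall x y, connect adjacent x y.

Definition acyclic_graph : Prop :=
  forall c : seq 'I_n, 2 < size c -> ~ ucycle adjacent c.

Definition is_tree : Prop :=
  [/\ simple_graph, connected_graph & acyclic_graph].

Definition simple_path (x : 'I_n) (s : seq 'I_n) : bool :=
  path adjacent x s && uniq (x :: s).

End Graphs.

(* As [n] vertices carry distinct labels in {0, ..., n-1}, each vertex is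
   identified with its label; a rooted tree is then a pair (root, edges). *)
Definition rooted_graph n := ('I_n * {set {set 'I_n}})%type.

Section RootedTrees.
Variables (n : nat) (T : rooted_graph n).
Let root := T.1.
Let E := T.2.

Definition is_child (v w : 'I_n) : Prop :=
  exists2 s, simple_path E root (rcons s w) & last root s = v.

Definition children (v : 'I_n) : {set 'I_n} := [set w | `[< is_child v w >]].

Definition is_leaf (v : 'I_n) : Prop := children v = set0.

Definition label_increasing : Prop :=
  forall s, simple_path E root s -> is_leaf (last root s) ->
    sorted ltn [seq val x | x <- root :: s].

Definition label_increasing_tree : Prop := is_tree E /\ label_increasing.

End RootedTrees.

Definition label_increasing_trees_bounded n k : {set rooted_graph n} :=
  [set T : rooted_graph n | `[< label_increasing_tree T /\
     forall v : 'I_n, v != T.1 -> #|children T v| <= k >]].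

(* Main.v *)
Require Import Defs.
From mathcomp Require Import all_boot.
From mathcomp Require Import boolp zify.

(** An increasing tree on {0, ..., n} is rooted at 0 and is determined by its
    parent function [p], which satisfies [p w < w]; reading off the parents of
    1, ..., n gives an inversion sequence, and the number of children of [v] is
    the number of occurrences of [v].  As an inversion sequence starts with 0,
    it contains 01...1 (with k ones) iff some nonzero value occurs at least k
    times, i.e. iff some vertex other than the root has at least k children. *)

Set Implicit Arguments.
Unset Strict Implicit.
Unset Printing Implicit Defensive.

(** * Containment of 01...1 in a sequence starting with 0 *)

(** The entries playing the ones are equal and exceed the entry playing the zero, so they are
    positive. Conversely, the leading 0 of [e] serves as the zero for any repeated positive
    value. *)
Lemma contains_zero_ones (e : seq nat) k : 0 < k -> head 0 e = 0 ->
  contains_pattern e (0 :: nseq k 1) <-> exists2 v, 0 < v & k <= count_mem v e.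
Proof.
move=> k0 e0; split=> [[s se [sz iso]]|[v v0 kv]].
- case: s se sz iso => [//|a s] se [sz] iso.
  rewrite size_nseq in sz.
  have lt_a i : i < k -> a < nth 0 s i.
    move=> ik; have [] := iso 0 i.+1; rewrite /= ?ltnS ?sz //.
    by rewrite nth_nseq ik.
  have eq_s i : i < k -> nth 0 s i = nth 0 s 0.
    move=> ik; have [] := iso i.+1 1; rewrite /= ?ltnS ?sz //.
    by rewrite !nth_nseq ik k0 => _ /eqP.
  exists (nth 0 s 0); first exact: leq_ltn_trans (lt_a 0 k0).
  apply: leq_trans (leq_count_subseq _ se) => /=.
  suff /all_pred1P-> : all (pred1 (nth 0 s 0)) s.
    by rewrite nth_nseq sz k0 count_nseq /= eqxx mul1n leq_addl.
  by apply/(all_nthP 0) => i; rewrite sz => /eq_s /= ->.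
- case: e e0 kv => [|a e] /=; first by rewrite leqn0 => _ /eqP k00; rewrite k00 in k0.
  move=> ->; rewrite eq_sym eqn0Ngt v0 add0n => kv.
  exists (0 :: nseq k v).
    rewrite /=; apply: subseq_trans (filter_subseq (pred1 v) e).
    have /all_pred1P -> : all (pred1 v) (filter (pred1 v) e) by exact: filter_all.
    rewrite size_filter -(subnKC kv) nseqD; exact: prefix_subseq.
  split; first by rewrite /= !size_nseq.
  by move=> [|i] [|j]; rewrite /= ?size_nseq ?ltnS ?nth_nseq => hi hj;
    rewrite ?hi ?hj ?ltnn ?eqxx ?v0 //; split; lia.
Qed.

(** * Edges and paths in acyclic graphs *)

Section Acyclic.
Variables (n : nat) (E : {set {set 'I_n}}).
Hypothesis acycE : acyclic_graph E.

Lemma adjacent_sym : symmetric (adjacent E).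
Proof. by move=> x y; rewrite /adjacent setUC. Qed.

(** A simple path avoiding the edge has at least two steps, so the edge closes it to a cycle on more
    than two vertices. *)
Lemma acyclic_bridge x y : x != y -> adjacent E x y ->
  ~ connect (adjacent (E :\ [set x; y])) x y.
Proof.
move=> xy Exy /connectP[s0 /shortenP[s ps us _] ys].
apply: (acycE (c := x :: s)).
  case: s ps us ys => [_ _ /= yx|z [|//]]; first by rewrite yx eqxx in xy.
  by move=> /= /andP[xz _] _ yz; move: xz; rewrite yz /adjacent !inE eqxx.
rewrite /ucycle us andbT /= rcons_path -ys adjacent_sym Exy andbT.
by apply: sub_path ps => a b; rewrite /adjacent !inE => /andP[].
Qed.

(** A path that misses [y] uses no edge at [y]. *)
Lemma path_avoiding r s x y : path (adjacent E) r s -> y \notin r :: s ->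
  connect (adjacent (E :\ [set x; y])) r (last r s).
Proof.
move=> ps ys; apply/connectP; exists s => //.
elim: s r ps ys => //= z s IHs r /andP[Erz ps].
rewrite inE negb_or => /andP[yr ys]; rewrite IHs // andbT /adjacent !inE.
rewrite -/(adjacent E r z) Erz andbT; apply: contraNneq ys => eq_e.
have: y \in [set r; z] by rewrite eq_e !inE eqxx orbT.
by rewrite !inE (negPf yr) /= => ->.
Qed.

(* Otherwise [s] and [t] would connect the ends of the edge without using it. *)
Lemma adjacent_simple_paths r s t :
  path (adjacent E) r s -> path (adjacent E) r t ->
  last r t \notin r :: s -> last r s \notin r :: t ->
  adjacent E (last r s) (last r t) -> False.
Proof.
move=> ps pt ys xt Exy; apply: (acyclic_bridge _ Exy).
  by apply: contraNneq xt => ->; exact: mem_last.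
apply: connect_trans (_ : connect _ _ r) _; last first.
  by rewrite setUC; exact: path_avoiding.
rewrite sym_connect_sym; first exact: path_avoiding.
by move=> a b; rewrite /adjacent setUC.
Qed.

End Acyclic.

(** * Children, parents and labels in a rooted tree *)

Section RootedTree.
Variables (n : nat) (T : rooted_graph n).
Hypothesis acycT : acyclic_graph T.2.

(** If [w] were on [s], cutting [s] at [w] would give a path to [w] missing [v], while the path
    witnessing the child relation reaches [v] and misses [w]; but [v] and [w] are adjacent. *)
Lemma child_notin_path v w s : is_child T v w -> simple_path T.2 T.1 s ->
  last T.1 s = v -> w \notin T.1 :: s.
Proof.
case=> s' /andP[]; rewrite rcons_path -rcons_cons rcons_uniq.
move=> /andP[ps' Evw] /andP[ws' us'] <- /andP[ps us] lsv; apply/negP => ws.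
case/splitPl: ws ps us lsv => s1 s2 ls1; rewrite cat_path => /andP[ps1 _].
rewrite -cat_cons cat_uniq last_cat ls1 => /and3P[_ /hasPn disj _] lsv.
apply: (adjacent_simple_paths acycT ps' ps1); rewrite ?ls1 //.
case: s2 disj lsv => [|a s2] disj /= lsv; last first.
  by apply: disj; rewrite -lsv mem_last.
by move: ws'; rewrite lsv mem_last.
Qed.

(** If [a] and [b] differed, the walk from [b] to the root, then to [a], then to [w] would bypass
    the edge between [b] and [w]: its first two legs miss [w]. *)
Lemma child_parent_uniq a b w : is_child T a w -> is_child T b w -> a = b.
Proof.
case=> s /andP[]; rewrite rcons_path -rcons_cons rcons_uniq.
move=> /andP[ps Eaw] /andP[ws us] la.
case=> t /andP[]; rewrite rcons_path -rcons_cons rcons_uniq.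
move=> /andP[pt Ebw] /andP[wt ut] lb; rewrite la in Eaw; rewrite lb in Ebw.
have bw : b != w by apply: contraNneq wt => <-; rewrite -lb mem_last.
have aw : a != w by apply: contraNneq ws => <-; rewrite -la mem_last.
apply/eqP/negPn/negP => ab; apply: (acyclic_bridge acycT bw Ebw).
apply: connect_trans (_ : connect _ _ T.1) _.
  rewrite sym_connect_sym; first by rewrite -{2}lb; exact: path_avoiding.
  by move=> x y; rewrite /adjacent setUC.
apply: connect_trans (_ : connect _ _ a) _.
  by rewrite -la; exact: path_avoiding.
apply: connect1; rewrite /adjacent !inE -/(adjacent T.2 a w) Eaw andbT.
apply: contraNneq ab => eq_e.
have: a \in [set b; w] by rewrite -eq_e !inE eqxx.
by rewrite !inE (negPf aw) orbF.
Qed.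

(* [label_increasing] only constrains paths ending in a leaf; extending to a
   leaf transfers it to every simple path from the root. *)
Lemma simple_path_to_leaf s : simple_path T.2 T.1 s ->
  exists2 t, simple_path T.2 T.1 (s ++ t) & is_leaf T (last T.1 (s ++ t)).
Proof.
have [m] := ubnP (n - size s); elim: m s => // m IHm s le_m ss.
have [leaf|] := pselect (is_leaf T (last T.1 s)).
  by exists [::]; rewrite cats0.
move/eqP/set0Pn => [u]; rewrite inE => /asboolP cu.
have us := child_notin_path cu ss erefl.
have Eu : adjacent T.2 (last T.1 s) u.
  by case: cu => s' /andP[]; rewrite rcons_path => /andP[_ +] _ ls'; rewrite ls'.
have ssu : simple_path T.2 T.1 (rcons s u).
  case/andP: ss => ps uniqs.
  by rewrite /simple_path rcons_path -rcons_cons rcons_uniq ps Eu us.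
have [|t] := IHm (rcons s u) _ ssu; last first.
  by rewrite cat_rcons => ? ?; exists (u :: t).
(* A simple path has at most [n] vertices, so the measure [n - size s] really drops. *)
case/andP: ssu => _ /card_uniqP uc.
have := max_card (mem (T.1 :: rcons s u)).
by rewrite uc card_ord /= size_rcons; lia.
Qed.

Hypothesis incT : label_increasing T.

Lemma increasing_simple_path s : simple_path T.2 T.1 s ->
  path ltn (val T.1) (map val s).
Proof.
case/simple_path_to_leaf => t st /(incT st) /=.
by rewrite map_cat cat_path => /andP[].
Qed.

Lemma simple_path_le_last s x : simple_path T.2 T.1 s -> x \in T.1 :: s ->
  x <= last T.1 s.
Proof.
move/increasing_simple_path; elim: s (T.1) x => [|y s IHs] r x /=.
  by rewrite inE => _ /eqP->.
case/andP=> ry ps; rewrite inE => /orP[/eqP->|xs]; last exact: IHs ps xs.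
have := IHs y y ps (mem_head _ _); exact: leq_trans (ltnW ry).
Qed.

Lemma child_lt v w : is_child T v w -> v < w.
Proof.
case=> s /increasing_simple_path; rewrite map_rcons rcons_path last_map.
by case/andP=> _ + <-.
Qed.

Lemma child_neq_root v w : is_child T v w -> w != T.1.
Proof.
case=> s /andP[_]; rewrite -rcons_cons rcons_uniq inE negb_or.
by case/andP=> /andP[].
Qed.

Hypothesis connT : connected_graph T.2.

Lemma simple_path_exists w : exists2 s, simple_path T.2 T.1 s & last T.1 s = w.
Proof.
have /connectP[s0 /shortenP[s ps us _] ws] := connT T.1 w.
by exists s => //; apply/andP.
Qed.

Lemma root_le (w : 'I_n) : T.1 <= w.
Proof.
have [s ss <-] := simple_path_exists w.
by apply: simple_path_le_last => //; rewrite mem_head.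
Qed.

Lemma parent_exists w : w != T.1 -> exists v, is_child T v w.
Proof.
have [s] := simple_path_exists w.
case/lastP: s => [|s x] ss; first by move=> /= ->; rewrite eqxx.
by rewrite last_rcons => <- _; exists (last T.1 s), s.
Qed.

Lemma child_adjacent v w : is_child T v w -> adjacent T.2 v w.
Proof. by case=> s /andP[]; rewrite rcons_path => /andP[_ +] _ <-. Qed.

(** Labels on a simple path from the root to [v] are at most [v], so the larger [w] is new and
    extends the path. *)
Lemma adjacent_lt_child v w : adjacent T.2 v w -> v < w -> is_child T v w.
Proof.
move=> Evw lt_vw; have [s ss lv] := simple_path_exists v.
exists s => //; rewrite /simple_path rcons_path lv Evw -rcons_cons rcons_uniq.
have [-> -> /=] := andP ss; rewrite !andbT.
by apply/negP => /(simple_path_le_last ss); rewrite lv leqNgt lt_vw.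
Qed.

End RootedTree.

(** * The tree of a decreasing parent function *)

Section ParentGraph.
Variable n : nat.
Implicit Types (p : 'I_n.+1 -> 'I_n.+1) (v w : 'I_n.+1).

Definition parent_graph p : {set {set 'I_n.+1}} :=
  [set [set w; p w] | w in [set~ ord0]].

Lemma adjacent_parent_graph p v w : adjacent (parent_graph p) v w =
  (w != ord0) && (p w == v) || (v != ord0) && (p v == w).
Proof.
apply/imsetP/idP => [[x]|/orP[]/andP[nz /eqP<-]].
- rewrite !inE => x0 /setP eq_e.
  have := eq_e (p x); have := eq_e w; have := eq_e v; have := eq_e x.
  rewrite !inE !eqxx !orbT /= => /orP[]/eqP eq_x; rewrite -{}eq_x !x0.
    move=> _ /esym/orP[]/eqP->; last by rewrite !eqxx !orbT.
    by rewrite orbb => ->; rewrite orbT.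
  move=> /esym/orP[]/eqP-> _; last by rewrite !eqxx.
  by rewrite orbb => ->.
- by exists w; rewrite ?inE // setUC.
- by exists v; rewrite ?inE.
Qed.

Variable p : 'I_n.+1 -> 'I_n.+1.
Hypothesis p_lt : forall w, w != ord0 -> p w < w.

Lemma parent_graph_simple : simple_graph (parent_graph p).
Proof.
move=> e /imsetP[w]; rewrite !inE => /p_lt lt_pw ->; rewrite cards2.
by case: eqVneq lt_pw => // <-; rewrite ltnn.
Qed.

(** The bound on the labels is carried through the induction because it shows that [v] is not
    already on the path to [p v]. *)
Lemma root_path_parent v : exists2 s, simple_path (parent_graph p) ord0 s &
  last ord0 s = v /\ {in ord0 :: s, forall x : 'I_n.+1, x <= v}.
Proof.
have [m] := ubnP (val v); elim: m v => // m IHm v le_m.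
have [->|v0] := eqVneq v ord0.
  by exists [::] => //; split=> // x; rewrite inE => /eqP->.
have [|s /andP[ps us] [ls le_s]] := IHm (p v).
  exact: leq_trans (p_lt v0) le_m.
exists (rcons s v); last first.
  split=> [|x]; first by rewrite last_rcons.
  rewrite -rcons_cons mem_rcons inE => /orP[/eqP-> //|/le_s].
  by move=> ?; apply: leq_trans (ltnW (p_lt v0)).
rewrite /simple_path rcons_path -rcons_cons rcons_uniq ps us ls andbT.
rewrite adjacent_parent_graph v0 eqxx /=.
by apply/negP => /le_s; rewrite leqNgt p_lt.
Qed.

Lemma parent_graph_connected : connected_graph (parent_graph p).
Proof.
have root_connect x : connect (adjacent (parent_graph p)) ord0 x.
  by have [s /andP[ps _] [ls _]] := root_path_parent x; apply/connectP; exists s.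
move=> x y; apply: connect_trans (root_connect y).
by rewrite sym_connect_sym //; exact: adjacent_sym.
Qed.

(** The largest vertex of a cycle would have two distinct neighbours on it, yet a neighbour that is
    not larger can only be its parent. *)
Lemma parent_graph_acyclic : acyclic_graph (parent_graph p).
Proof.
move=> c szc uc; have [i0 i0c] : exists i0, i0 \in c.
  by case: c szc {uc} => // i0 c; exists i0; rewrite mem_head.
case: (@arg_maxnP _ i0 (mem c) val i0c) => m mc max_m.
have parent_of_max a : a \in c -> adjacent (parent_graph p) m a -> p m = a.
  move=> /max_m /= le_am; rewrite adjacent_parent_graph.
  case/orP=> /andP[nz /eqP//].
  by move=> pa; have := p_lt nz; rewrite pa ltnNge => /negP[].
have [i s def_c] := rot_to mc.
rewrite -(rot_ucycle i) def_c in uc.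
have mem_c a : a \in m :: s -> a \in c by rewrite -def_c mem_rot.
have {}szc : 1 < size s by rewrite -(size_rot i) def_c in szc.
case/andP: uc; case: s szc mem_c {def_c} => [//|a [//|b s]] _ mem_c /=.
rewrite rcons_path => /and4P[ma _ _ bm] /and3P[_ + _].
rewrite adjacent_sym in bm.
rewrite -(parent_of_max a) ?mem_c ?inE ?eqxx ?orbT //.
rewrite (parent_of_max _ _ bm) -?in_cons ?mem_last //.
by apply: mem_c; rewrite !inE -in_cons mem_last !orbT.
Qed.

Lemma parent_graph_is_tree : is_tree (parent_graph p).
Proof.
split; [exact: parent_graph_simple|exact: parent_graph_connected|].
exact: parent_graph_acyclic.
Qed.

(* A simple path cannot turn back towards the root, since the only smaller
   neighbour of a vertex is its parent, the vertex the path came from. *)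
Lemma simple_path_parent s : simple_path (parent_graph p) ord0 s ->
  path (fun v w => (w != ord0) && (p w == v)) ord0 s.
Proof.
have aux x y t : p y = x -> path (adjacent (parent_graph p)) y t ->
    uniq [:: x, y & t] -> path (fun v w => (w != ord0) && (p w == v)) y t.
  elim: t x y => //= z t IHt x y pyx /andP[yz pt] /andP[xt ut].
  have pzy : (z != ord0) && (p z == y).
    move: yz; rewrite adjacent_parent_graph => /orP[//|/andP[_ /eqP pyz]].
    by rewrite -pyx pyz !inE eqxx orbT in xt.
  by rewrite pzy; apply: IHt pt ut; case/andP: pzy => _ /eqP.
case: s => //= y t /andP[/= /andP[adj pt] ut].
move: adj; rewrite adjacent_parent_graph eqxx orbF => py.
by rewrite py; apply: aux pt ut; case/andP: py => _ /eqP.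
Qed.

Lemma is_child_parent_graph v w :
  is_child (ord0, parent_graph p) v w <-> w != ord0 /\ p w = v.
Proof.
split=> [[s /simple_path_parent]|[w0 <-]].
  by rewrite rcons_path => /andP[_ /andP[w0 /eqP pw]] <-.
have [s /andP[ps us] [ls le_s]] := root_path_parent (p w).
exists s => //.
rewrite /simple_path rcons_path -rcons_cons rcons_uniq ps us ls andbT.
rewrite adjacent_parent_graph w0 eqxx /=.
by apply/negP => /le_s; rewrite leqNgt p_lt.
Qed.

Lemma parent_graph_increasing : label_increasing (ord0, parent_graph p).
Proof.
move=> s /simple_path_parent ps _; rewrite [sorted _ _]path_map.
by apply: sub_path ps => v w /andP[/p_lt + /eqP<-].
Qed.

End ParentGraph.

(** Every edge, directed from its smaller to its larger label, joins a parent to its child, and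
    parents are unique. The value of [p] at the root is arbitrary. *)
Lemma increasing_tree_parent_graph n (T : rooted_graph n.+1) :
  label_increasing_tree T ->
  exists2 p : 'I_n.+1 -> 'I_n.+1, forall w, w != ord0 -> p w < w &
    T = (ord0, parent_graph p).
Proof.
case=> [[simT connT acycT] incT].
have T0 : T.1 = ord0.
  by apply/val_inj/eqP; rewrite -leqn0; exact: (root_le acycT incT connT ord0).
have /choice[p pP] (w : 'I_n.+1) : exists v, w != ord0 -> is_child T v w.
  have [_|w0] := eqVneq w ord0; first by exists w.
  by have [|v] := parent_exists connT (w := w); rewrite ?T0 //; exists v.
exists p => [w /pP|]; first exact: child_lt.
rewrite [T]surjective_pairing T0; congr pair; apply/setP => e.
apply/idP/imsetP => [eE|[w]]; last first.
  by rewrite !inE => /pP /child_adjacent Epw ->; rewrite setUC.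
have /eqP/cards2P[a [b [ab e_ab]]] := simT _ eE.
wlog lt_ab : a b ab e_ab / a < b => [wl|].
  have [|lt_ba|/val_inj eq_ab] := ltngtP a b; first exact: wl.
    by apply: (wl b a); rewrite 1?eq_sym 1?setUC.
  by rewrite eq_ab eqxx in ab.
have ab_child : is_child T a b.
  by apply: adjacent_lt_child; rewrite // /adjacent -e_ab.
have b0 : b != ord0 by rewrite -T0; exact: child_neq_root ab_child.
exists b; rewrite ?inE // e_ab setUC; congr [set _; _].
exact: child_parent_uniq ab_child (pP _ b0).
Qed.

(** * The bijection between inversion sequences and increasing trees *)

Section InversionSequenceTree.
Variable n : nat.
Implicit Types e : n.-tuple 'I_n.

(** The entry at 0-based position [i] is the parent of vertex [i + 1]; the value at the root is a
    dummy. *)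
Definition parent_of e (w : 'I_n.+1) : 'I_n.+1 :=
  if unlift ord0 w is Some i then widen_ord (leqnSn n) (tnth e i) else ord0.

Definition tree_of e : rooted_graph n.+1 := (ord0, parent_graph (parent_of e)).

Lemma parent_of_lift e i : parent_of e (lift ord0 i) = tnth e i :> nat.
Proof. by rewrite /parent_of liftK. Qed.

Lemma parent_of_lt e w : e \in inversion_sequences n -> w != ord0 ->
  parent_of e w < w.
Proof.
rewrite inE => /forallP inv; case: (unliftP ord0 w) => [i ->|->] // _.
by rewrite parent_of_lift; exact: inv.
Qed.

(** The child relation of the tree determines the parent of each nonroot vertex, hence each
    entry. *)
Lemma tree_of_inj : {in inversion_sequences n &, injective tree_of}.
Proof.
move=> e e' inv inv' [eq_E]; apply: eq_from_tnth => i.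
apply: val_inj; rewrite /= -!parent_of_lift; congr val.
have : is_child (tree_of e) (parent_of e (lift ord0 i)) (lift ord0 i).
  by apply/is_child_parent_graph => // w; exact: parent_of_lt.
rewrite /tree_of eq_E => /is_child_parent_graph[] => [w|_ -> //].
exact: parent_of_lt.
Qed.

Lemma card_children_tree_of e (v : 'I_n.+1) : e \in inversion_sequences n ->
  #|children (tree_of e) v| = count_mem (val v) (map val e).
Proof.
move=> inv; have p_lt w := @parent_of_lt e w inv.
have -> : children (tree_of e) v =
    lift ord0 @: [set i : 'I_n | val (tnth e i) == v].
  apply/setP => w; rewrite inE; apply/asboolP/imsetP.
    move/(is_child_parent_graph p_lt) => [w0 pw].
    case: (unliftP ord0 w) w0 pw => [i ->|->] // _ pi.
    by exists i; rewrite // inE -pi parent_of_lift.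
  case=> i; rewrite inE => /eqP ei ->; apply/(is_child_parent_graph p_lt).
  by split=> //; apply: val_inj; rewrite /= parent_of_lift.
rewrite card_imset; last exact: lift_inj.
rewrite count_map -(map_tnth_enum e) count_map cardsE cardE size_filter -enumT.
exact: eq_count.
Qed.

Lemma tree_of_onto (p : 'I_n.+1 -> 'I_n.+1) : (forall w : 'I_n.+1, w != ord0 -> p w < w) ->
  exists2 e, e \in inversion_sequences n &
    (ord0, parent_graph p) = tree_of e.
Proof.
(* The default [i] of [insubd] is never taken: the parent of vertex [i + 1] is at most [i], hence
   below [n]. *)
move=> p_lt; pose e := [tuple insubd i (val (p (lift ord0 i))) | i < n].
have eE i : tnth e i = p (lift ord0 i) :> nat.
  have := p_lt (lift ord0 i) isT; rewrite tnth_mktuple val_insubd.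
  by rewrite /= /bump /= add1n ltnS => le_pi; rewrite (leq_ltn_trans le_pi).
exists e.
  by rewrite inE; apply/forallP => i; rewrite eE; exact: p_lt.
rewrite /tree_of /parent_graph; congr pair; apply: eq_in_imset => w.
rewrite !inE; case: (unliftP ord0 w) => [i ->|->] // _.
by congr [set _; _]; apply: val_inj; rewrite /= parent_of_lift eE.
Qed.

Lemma avoiding_zero_ones e k : 0 < k -> e \in inversion_sequences n ->
  (e \in inversion_sequences_avoiding n (0 :: nseq k 1)) =
  [forall v : 'I_n.+1, (v != ord0) ==> (#|children (tree_of e) v| < k)].
Proof.
move=> k0 inv; rewrite !inE.
have inv' := inv; rewrite inE in inv'; rewrite inv' /=.
have e0 : head 0 (map val e) = 0.
  (* The first entry is below 1; on the empty sequence [head] returns its default 0. *)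
  move/forallP: inv'; case: n e {inv} => [|m] e inv; first by rewrite tuple0.
  have := inv ord0; rewrite ltnS leqn0 (tnth_nth ord0) -nth0.
  by case: (tval e) => // a l /= /eqP.
apply/asboolPn/forallP => [av v|ch /(contains_zero_ones k0 e0) [v v0 kv]].
  apply/implyP => v0; rewrite card_children_tree_of // ltnNge.
  apply/negP => kv; apply: av; apply/(contains_zero_ones k0 e0).
  by exists (val v); rewrite // lt0n.
(* As [k] is positive, [v] does occur in [e], so it is the label of a vertex. *)
have vn : v < n.+1.
  have : has (pred1 v) (map val e) by rewrite has_count (leq_trans k0).
  case/hasP => _ /mapP[x _ ->] /= /eqP <-; exact: ltnW (ltn_ord x).
have := ch (Ordinal vn); rewrite card_children_tree_of //= -val_eqE /= -lt0n v0 /=.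
by rewrite ltnNge kv.
Qed.

End InversionSequenceTree.

Theorem theorem4p2 (k n : nat) (hk : 1 <= k) (hn : 1 <= n) :
  #|inversion_sequences_avoiding n (0 :: nseq k 1)| =
  #|label_increasing_trees_bounded n.+1 (k - 1)|.
Proof.
have sub_inv e : e \in inversion_sequences_avoiding n (0 :: nseq k 1) ->
    e \in inversion_sequences n by rewrite inE => /andP[].
rewrite -(@card_in_imset _ _ (@tree_of n)); last first.
  by move=> e e' /sub_inv inv /sub_inv inv'; exact: tree_of_inj.
apply: eq_card => T; rewrite [RHS]inE; apply/imsetP/asboolP.
  case=> e av ->; have inv := sub_inv _ av.
  have p_lt w := @parent_of_lt n e w inv.
  rewrite avoiding_zero_ones // in av; split.
    by split; [exact: parent_graph_is_tree|exact: parent_graph_increasing].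
  move=> v v0; move/forallP/(_ v)/implyP/(_ v0): av; lia.
case=> /increasing_tree_parent_graph[p /tree_of_onto[e inv ->] ->] bnd.
exists e => //; rewrite avoiding_zero_ones //.
by apply/forallP => v; apply/implyP => /bnd; lia.
Qed.
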